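(* Suppose that $R$ is a commutative noetherian ring and $A$ is locally finite. If every finitely generated graded $A$-module is centrally stable, then every finitely generated graded $A$-module is noetherian.
   Context: $\mathbb{Z}_+$ is the set of non-negative integers. $\mathcal{A}$ is an $R$-linear category (a category enriched over $R$-modules) with $\operatorname{Ob}(\mathcal{A})=\mathbb{Z}_+$ and $\operatorname{Hom}_{\mathcal{A}}(m,n)=0$ whenever $m>n$. Its category algebra is the (non-unital) $R$-algebra $A=\bigoplus_{m,n\in\mathbb{Z}_+}\operatorname{Hom}_{\mathcal{A}}(m,n)$, with product given by composition (and zero when morphisms are not composable). $A$ is called locally finite if $\operatorname{Hom}_{\mathcal{A}}(m,n)$ is a finitely generated $R$-module for all $m,n\in\mathbb{Z}_+$. For $n\in\mathbb{Z}_+$, $e_n\in A$ is the identity endomorphism of $n$; for $m\leqslant n$, $e_{m,n}:=e_m+e_{m+1}+\cdots+e_n$. A graded $A$-module is an $A$-module $V$ with $V=\bigoplus_{n\in\mathbb{Z}_+}e_nV$ (every $A$-submodule of a graded $A$-module is then graded). It is finitely generated if it is finitely generated as an $A$-module; equivalently, for some $N\in\mathbb{Z}_+$ there is an exact sequence $\bigoplus_{i\in I}Ae_{0,N}\to V\to 0$ with $I$ finite. It is noetherian if every $A$-submodule of $V$ is finitely generated. It is centrally stable if for all $N$ sufficiently large one has $Ae\otimes_{eAe}eV\cong V$ (as $A$-modules), where $e=e_{0,N}$. *)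

(* Defs.v *)
From HB Require Import structures.
From mathcomp Require Import all_boot all_order all_algebra.
From mathcomp Require Import generic_quotient ring_quotient.
From mathcomp Require Import boolp classical_sets functions cardinality fsbigop.

Set Implicit Arguments.
Unset Strict Implicit.
Unset Printing Implicit Defensive.

Import GRing.Theory.
Local Open Scope classical_set_scope.
Local Open Scope ring_scope.
Local Open Scope quotient_scope.

Section Submodules.
Variables (R : comPzRingType) (V : lmodType R).

Definition submodule (W : set V) : Prop := submod_closed [in W].

Definition lspan (X : set V) : set V := smallest submodule X.

Definition fg_submodule (W : set V) : Prop :=
  exists s : seq V, W = lspan [set` s].

Lemma submoduleP (W : set V) :
  submodule W <-> W 0 /\ forall r u v, W u -> W v -> W (r *: u + v).
Proof.
rewrite /submodule; split=> -[W0 Wlin]; split.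
- by move: W0; rewrite inE.
- by move=> r u v Wu Wv; have := Wlin r u v; rewrite !inE; apply.
- by rewrite inE.
- by move=> r u v; rewrite !inE; exact: Wlin.
Qed.

Lemma lspan_submodule (G : set V) : submodule (lspan G).
Proof.
apply/submoduleP; split=> [W [/submoduleP[W0 _] _] //|r u v Gu Gv W GW].
have /submoduleP[_ Wlin] := GW.1.
by apply: Wlin; [exact: Gu | exact: Gv].
Qed.

End Submodules.

Lemma linear_map0 (R : comPzRingType) (U V : lmodType R) (f : U -> V) :
  linear f -> f 0 = 0.
Proof. by move=> /(_ (-1) 0 0); rewrite !scaleN1r !addNr. Qed.

Lemma submodule_range (R : comPzRingType) (U V : lmodType R) (f : U -> V) :
  linear f -> submodule (range f).
Proof.
move=> flin; apply/submoduleP; split.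
  by exists 0 => //; exact: linear_map0.
by move=> r _ _ [u _ <-] [v _ <-]; exists (r *: u + v) => //; exact: flin.
Qed.

Definition fg_module (R : comPzRingType) (V : lmodType R) : Prop :=
  fg_submodule [set: V].

(* The ideals of R are the submodules of the regular module R^o. *)
Definition noetherian_ring (R : comPzRingType) : Prop :=
  forall I : set R^o, submodule I -> fg_submodule I.

Section SubAndQuotient.
Variables (R : comPzRingType) (V : lmodType R) (W : set V).
Variable hW : submodule W.

Definition sub_pred of submodule W : pred V := fun x => x \in W.

Lemma sub_pred_closed : subsemimod_closed (sub_pred hW).
Proof. exact: GRing.submod_closed_semi hW. Qed.

HB.instance Definition _ :=
  GRing.isSubmodClosed.Build R V (sub_pred hW) sub_pred_closed.

(* W as a module in its own right; lval is the embedding into V. *)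
Definition lsub : Type := {x : V | sub_pred hW x}.
HB.instance Definition _ := SubChoice.on lsub.
HB.instance Definition _ := [SubChoice_isSubLmodule of lsub by <:].

Lemma lsubP (x : V) : W x -> sub_pred hW x.
Proof. by move=> Wx; apply/mem_set. Qed.

Definition inlsub (x : V) (Wx : W x) : lsub := Sub x (lsubP Wx).

Definition lval (u : lsub) : V := val u.

Lemma lval_inj : injective lval. Proof. exact: val_inj. Qed.

Lemma lval_mem (u : lsub) : W (lval u).
Proof. exact: set_mem (valP u). Qed.

Lemma lval_linear : linear lval. Proof. by []. Qed.

Lemma inlsubK (x : V) (Wx : W x) : lval (inlsub Wx) = x.
Proof. by []. Qed.

(* The quotient module V / W, with projection lproj. *)
Definition lquot : Type := @Quotient.quot V (GRing.ZmodClosed.clone V (sub_pred hW) _).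
HB.instance Definition _ := GRing.Zmodule.on lquot.
HB.instance Definition _ := EqQuotient.on lquot.

Definition lproj (x : V) : lquot := \pi_lquot x.

Definition lrepr (x : lquot) : V := repr x.

Lemma lreprK : cancel lrepr lproj. Proof. exact: reprK. Qed.

Lemma lproj_eq (x y : V) : lproj x = lproj y <-> W (x - y).
Proof.
rewrite /lproj; split=> [/eqP|Wxy].
  by rewrite -Quotient.idealrBE => /set_mem.
by apply/eqP; rewrite -Quotient.idealrBE; apply/mem_set.
Qed.

Lemma lprojD x y : lproj (x + y) = lproj x + lproj y.
Proof. exact: raddfD. Qed.

Definition lquot_scale (r : R) (x : lquot) : lquot := lproj (r *: lrepr x).

Lemma lproj_scale r x : lquot_scale r (lproj x) = lproj (r *: x).
Proof.
apply/lproj_eq; rewrite -scalerBr.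
have /lproj_eq Wx : lproj (lrepr (lproj x)) = lproj x by rewrite lreprK.
have /submoduleP[W0 Wl] := hW.
by rewrite -[_ *: _]addr0; apply: Wl.
Qed.

Lemma lproj_surj (x : lquot) : exists y, x = lproj y.
Proof. by exists (lrepr x); rewrite lreprK. Qed.

Lemma lquot_scalerA a b x :
  lquot_scale a (lquot_scale b x) = lquot_scale (a * b) x.
Proof. by have [y ->] := lproj_surj x; rewrite !lproj_scale scalerA. Qed.

Lemma lquot_scale1r : left_id 1 lquot_scale.
Proof. by move=> x; have [y ->] := lproj_surj x; rewrite lproj_scale scale1r. Qed.

Lemma lquot_scalerDr : right_distributive lquot_scale +%R.
Proof.
move=> a x y; have [x' ->] := lproj_surj x; have [y' ->] := lproj_surj y.
by rewrite -lprojD !lproj_scale scalerDr lprojD.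
Qed.

Lemma lquot_scalerDl x : {morph lquot_scale^~ x : a b / a + b}.
Proof.
move=> a b; have [x' ->] := lproj_surj x.
by rewrite !lproj_scale scalerDl lprojD.
Qed.

HB.instance Definition _ := GRing.Zmodule_isLmodule.Build R lquot
  lquot_scalerA lquot_scale1r lquot_scalerDr lquot_scalerDl.

Lemma lproj_linear : linear lproj.
Proof. by move=> r u v; rewrite lprojD -lproj_scale. Qed.

End SubAndQuotient.

Section DirectSum.
Variables (R : comPzRingType) (I : choiceType) (M : I -> lmodType R).

Definition dprod : Type := forall i, M i.
Implicit Types f g h : dprod.

HB.instance Definition _ := Choice.on dprod.

Definition dprod_zero : dprod := fun=> 0.
Definition dprod_add f g : dprod := fun i => f i + g i.
Definition dprod_opp f : dprod := fun i => - f i.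
Definition dprod_scale (r : R) f : dprod := fun i => r *: f i.

Let ext f g : (forall i, f i = g i) -> f = g. Proof. exact: functional_extensionality_dep. Qed.

Lemma dprod_addA : associative dprod_add.
Proof. by move=> f g h; apply: ext => i; exact: addrA. Qed.
Lemma dprod_addC : commutative dprod_add.
Proof. by move=> f g; apply: ext => i; exact: addrC. Qed.
Lemma dprod_add0 : left_id dprod_zero dprod_add.
Proof. by move=> f; apply: ext => i; exact: add0r. Qed.
Lemma dprod_addN : left_inverse dprod_zero dprod_opp dprod_add.
Proof. by move=> f; apply: ext => i; exact: addNr. Qed.

HB.instance Definition _ := GRing.isZmodule.Build dprod
  dprod_addA dprod_addC dprod_add0 dprod_addN.

Lemma dprod_scaleA a b f : dprod_scale a (dprod_scale b f) = dprod_scale (a * b) f.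
Proof. by apply: ext => i; exact: scalerA. Qed.
Lemma dprod_scale1 : left_id 1 dprod_scale.
Proof. by move=> f; apply: ext => i; exact: scale1r. Qed.
Lemma dprod_scaleDr : right_distributive dprod_scale +%R.
Proof. by move=> a f g; apply: ext => i; exact: scalerDr. Qed.
Lemma dprod_scaleDl f : {morph dprod_scale^~ f : a b / a + b}.
Proof. by move=> a b; apply: ext => i; exact: scalerDl. Qed.

HB.instance Definition _ := GRing.Zmodule_isLmodule.Build R dprod
  dprod_scaleA dprod_scale1 dprod_scaleDr dprod_scaleDl.

Definition finsupp (f : dprod) : Prop := finite_set [set i | f i != 0].

Lemma finsupp_submodule : submodule [set f : dprod | finsupp f].
Proof.
apply/submoduleP; split=> [|r f g ff fg] /=.
  by apply: (sub_finite_set _ (@finite_set0 I)) => i /=; rewrite eqxx.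
apply: (@sub_finite_set _ _ ([set i | f i != 0] `|` [set i | g i != 0])).
  move=> i /= fgi; have [fi0|] := eqVneq (f i) 0; [right|by left].
  apply: contraNneq fgi => gi0.
  by rewrite -[(r *: f + g) i]/(r *: f i + g i) fi0 gi0 scaler0 addr0.
by rewrite finite_setU.
Qed.

Definition dsum : lmodType R := lsub finsupp_submodule.

(* The component of u in the summand M i. *)
Definition coord (u : dsum) (i : I) : M i := (lval u : dprod) i.

Lemma dsum_ext (u v : dsum) : (forall i, coord u i = coord v i) -> u = v.
Proof. by move=> uv; apply/lval_inj/ext. Qed.

Lemma coord_linear i : linear (coord^~ i).
Proof. by []. Qed.

Lemma coord_finite (u : dsum) : finite_set [set i | coord u i != 0].
Proof. exact: lval_mem u. Qed.

Definition mkdsum (f : forall i, M i) (ff : finite_set [set i | f i != 0]) :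
  dsum := inlsub finsupp_submodule ff.

Lemma coord_mkdsum (f : forall i, M i) (ff : finite_set [set i | f i != 0]) i :
  coord (mkdsum ff) i = f i.
Proof. by []. Qed.

Lemma dinj_finite i (x : M i) :
  finite_set [set j | dfwith (fun k => 0 : M k) x j != 0].
Proof.
apply: (sub_finite_set _ (finite_set1 i)) => j /=.
by apply: contra_neqP => /eqP; rewrite eq_sym => ji; rewrite dfwith_out.
Qed.

(* The canonical injection of the summand M i. *)
Definition dinj i (x : M i) : dsum := mkdsum (dinj_finite x).

Lemma dinj_in i (x : M i) : coord (dinj x) i = x.
Proof. exact: dfwith_in. Qed.

Lemma dinj_out i (x : M i) j : i != j -> coord (dinj x) j = 0.
Proof. by move=> ij; rewrite coord_mkdsum dfwith_out. Qed.

Lemma dinj_linear i : linear (@dinj i).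
Proof.
move=> r x y; apply: dsum_ext => j; rewrite coord_linear.
have [<-|ij] := eqVneq i j; first by rewrite !dinj_in.
by rewrite !dinj_out // scaler0 addr0.
Qed.

End DirectSum.

Section FreeModule.
Variables (R : comPzRingType) (I : choiceType).

(* The free R-module on the set I, with basis (fbase i)_i. *)
Definition free_module : lmodType R := dsum (fun _ : I => R^o : lmodType R).

Definition fbase (i : I) : free_module :=
  @dinj R I (fun _ => R^o) i 1.

Variable W : lmodType R.

(* The R-linear map sending each fbase i to f i. *)
Definition free_lift (f : I -> W) (z : free_module) : W :=
  \sum_(i \in [set: I]) (coord z i : R) *: f i.

Lemma free_liftE (f : I -> W) (z : free_module) (r : seq I) : uniq r ->
  (forall i, i \notin r -> coord z i = 0) ->
  free_lift f z = \sum_(i <- r) (coord z i : R) *: f i.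
Proof.
move=> ru z0; rewrite /free_lift (fsbigE r) //.
  by apply: eq_bigl => i; rewrite in_setT.
by move=> i _ /z0 ->; rewrite scale0r.
Qed.

Lemma free_supp (z : free_module) :
  exists r : seq I, forall i, i \notin r -> coord z i = 0.
Proof.
have /finite_seqP[r rE] := coord_finite z.
exists r => i; apply: contraNeq => zi0.
by have : [set j | coord z j != 0] i by []; rewrite rE.
Qed.

Let free_moduleE a (u v : free_module) i :
  coord (a *: u + v) i = a * (coord u i : R) + coord v i :> R.
Proof. by []. Qed.

Lemma free_lift_linear (f : I -> W) : linear (free_lift f).
Proof.
move=> a u v; have [ru hu] := free_supp u; have [rv hv] := free_supp v.
pose r := undup (ru ++ rv).
have r_u i : i \notin r -> coord u i = 0.
  by rewrite mem_undup mem_cat negb_or => /andP[/hu].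
have r_v i : i \notin r -> coord v i = 0.
  by rewrite mem_undup mem_cat negb_or => /andP[_ /hv].
rewrite !(@free_liftE f _ r) ?undup_uniq // => [|i ir]; last first.
  by rewrite free_moduleE r_u // r_v // mulr0 addr0.
rewrite scaler_sumr -big_split; apply: eq_bigr => i _ /=.
by rewrite free_moduleE scalerDl scalerA.
Qed.

Lemma free_lift_base (f : I -> W) i : free_lift f (fbase i) = f i.
Proof.
rewrite (@free_liftE f _ [:: i]) // => [|j].
  by rewrite big_seq1 dinj_in scale1r.
by rewrite inE eq_sym => ij; rewrite dinj_out.
Qed.

End FreeModule.
Arguments fbase R {I} i.

Lemma free_lift_id (R : comPzRingType) (I : choiceType) (z : free_module R I) :
  free_lift (fbase R) z = z.
Proof.
have [r hr] := free_supp z.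
rewrite (@free_liftE _ _ _ _ _ (undup r)) ?undup_uniq // => [|i]; last first.
  by rewrite mem_undup; exact: hr.
apply: dsum_ext => j.
have -> (s : seq I) : coord (\sum_(i <- s) (coord z i : R) *: fbase R i) j =
    \sum_(i <- s) (coord z i : R) * (coord (fbase R i) j : R).
  elim: s => [|i s IHs]; first by rewrite !big_nil.
  by rewrite !big_cons -IHs.
have [jr|jr] := boolP (j \in undup r).
  rewrite (bigD1_seq j) ?undup_uniq //= dinj_in mulr1 big1_seq ?addr0 //.
  by move=> i /andP[ij _]; rewrite dinj_out // mulr0.
rewrite hr; last by move: jr; rewrite mem_undup.
rewrite big1_seq // => i /andP[_ ir].
by rewrite dinj_out ?mulr0 //; apply: contraNneq jr => <-.
Qed.

(* The tensor product over an R-algebra S of a right S-module M and a left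
   S-module N, as the quotient of the free R-module on M * N by the usual
   relations. The structure of S enters only through its actions. *)
Section Tensor.
Variables (R : comPzRingType) (S : Type) (M N : lmodType R).
Variables (ra : M -> S -> M) (la : S -> N -> N).

Let F : lmodType R := free_module R (M * N)%type.
Let b (x : M) (y : N) : F := fbase R (x, y).

Inductive tensor_rel : set F :=
| tensor_relDl r x x' y : tensor_rel (b (r *: x + x') y - (r *: b x y + b x' y))
| tensor_relDr r x y y' : tensor_rel (b x (r *: y + y') - (r *: b x y + b x y'))
| tensor_relS x s y : tensor_rel (b (ra x s) y - b x (la s y)).

Definition tensor : lmodType R := lquot (lspan_submodule tensor_rel).

Definition pure_tensor (x : M) (y : N) : tensor :=
  lproj (lspan_submodule tensor_rel) (b x y).

Let proj : F -> tensor := lproj (lspan_submodule tensor_rel).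

Let proj_rel u v : tensor_rel (u - v) -> proj u = proj v.
Proof. by move=> uv; apply/lproj_eq; exact: sub_gen_smallest. Qed.

Lemma pure_tensor_linl y : linear (pure_tensor^~ y).
Proof.
move=> r x x'; rewrite /pure_tensor -lproj_linear.
by apply: proj_rel; exact: tensor_relDl.
Qed.

Lemma pure_tensor_linr x : linear (pure_tensor x).
Proof.
move=> r y y'; rewrite /pure_tensor -lproj_linear.
by apply: proj_rel; exact: tensor_relDr.
Qed.

Lemma pure_tensor_mid x s y : pure_tensor (ra x s) y = pure_tensor x (la s y).
Proof. by apply: proj_rel; exact: tensor_relS. Qed.

Section Lift.
Variables (W : lmodType R).

Definition balanced (g : M -> N -> W) : Prop :=
  [/\ forall y, linear (g^~ y), forall x, linear (g x)
    & forall x s y, g (ra x s) y = g x (la s y)].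

(* For balanced g, the R-linear map sending each x (x) y to g x y. *)
Definition tensor_lift (g : M -> N -> W) (t : tensor) : W :=
  free_lift (fun p => g p.1 p.2) (lrepr t).

Variable g : M -> N -> W.
Hypothesis gB : balanced g.

Let gl : F -> W := free_lift (fun p => g p.1 p.2).
Let gl_lin : linear gl. Proof. exact: free_lift_linear. Qed.
Let gl_base x y : gl (b x y) = g x y. Proof. exact: free_lift_base. Qed.

Let gl_sub u v : gl (u - v) = gl u - gl v.
Proof. by rewrite addrC -scaleN1r gl_lin scaleN1r addrC. Qed.

Let gl_ker (z : F) : lspan tensor_rel z -> gl z = 0.
Proof.
apply: (@smallest_sub _ _ _ [set z | gl z = 0]) => /=.
  apply/submoduleP; split=> [|r u v /= gu gv].
    exact: linear_map0.
  by rewrite gl_lin gu gv scaler0 addr0.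
have [glin1 glin2 gmid] := gB.
move=> _ [r x x' y|r x y y'|x s y] /=; rewrite gl_sub ?gl_lin !gl_base.
- by rewrite glin1 subrr.
- by rewrite glin2 subrr.
- by rewrite gmid subrr.
Qed.

Lemma tensor_lift_proj z : tensor_lift g (proj z) = gl z.
Proof.
apply/eqP; rewrite -subr_eq0 -/gl -[tensor_lift _ _]/(gl _) -gl_sub.
apply/eqP/gl_ker/(lproj_eq (lspan_submodule tensor_rel)).
exact: lreprK.
Qed.

Lemma tensor_lift_pure x y : tensor_lift g (pure_tensor x y) = g x y.
Proof. by rewrite -gl_base -tensor_lift_proj. Qed.

Lemma tensor_lift_linear : linear (tensor_lift g).
Proof.
move=> r s t; have [u ->] := lproj_surj s; have [v ->] := lproj_surj t.
by rewrite -lproj_linear !tensor_lift_proj gl_lin.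
Qed.

End Lift.

Lemma tensor_ind (P : tensor -> Prop) : P 0 ->
  (forall r s t, P s -> P t -> P (r *: s + t)) ->
  (forall x y, P (pure_tensor x y)) -> forall t, P t.
Proof.
move=> P0 Plin Pb t; have [z ->] := lproj_surj t.
rewrite -(free_lift_id z); have [r hr] := free_supp z.
rewrite (@free_liftE _ _ _ _ _ (undup r)) ?undup_uniq // => [|i]; last first.
  by rewrite mem_undup; exact: hr.
elim: (undup r) => [|[x y] s IHs].
  by rewrite big_nil (linear_map0 (@lproj_linear _ _ _ _)).
by rewrite big_cons lproj_linear; apply: Plin; [exact: Pb|exact: IHs].
Qed.

Lemma tensor_lift_unique (W : lmodType R) (f g : tensor -> W) :
  linear f -> linear g ->
  (forall x y, f (pure_tensor x y) = g (pure_tensor x y)) -> f =1 g.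
Proof.
move=> flin glin fg; apply: tensor_ind => [|r s t fs ft|//].
  by rewrite !linear_map0.
by rewrite flin glin fs ft.
Qed.

End Tensor.

(* An R-linear category with set of objects nat, without nonzero morphisms
   m -> n for m > n. *)
Record lincat (R : comPzRingType) := LinCat {
  cat_hom : nat -> nat -> lmodType R;
  hid : forall n, cat_hom n n;
  hcomp : forall m n p, cat_hom n p -> cat_hom m n -> cat_hom m p;
  hcomp_linl : forall m n p (f : cat_hom m n),
    linear (fun g : cat_hom n p => hcomp g f);
  hcomp_linr : forall m n p (g : cat_hom n p),
    linear (fun f : cat_hom m n => hcomp g f);
  hcompA : forall m n p q (h : cat_hom p q) (g : cat_hom n p) (f : cat_hom m n),
    hcomp h (hcomp g f) = hcomp (hcomp h g) f;
  hcomp1f : forall m n (f : cat_hom m n), hcomp (hid n) f = f;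
  hcompf1 : forall m n (f : cat_hom m n), hcomp f (hid m) = f;
  hom_eq0 : forall m n, (n < m)%N -> forall f : cat_hom m n, f = 0
}.

Section CategoryAlgebra.
Variables (R : comPzRingType) (C : lincat R).

Definition catalg : lmodType R := dsum (fun p : nat * nat => cat_hom C p.1 p.2).
Implicit Types a b c : catalg.

(* The morphism f : m -> n as an element of the category algebra. *)
Definition hinj m n (f : cat_hom C m n) : catalg :=
  @dinj R _ (fun p : nat * nat => cat_hom C p.1 p.2) (m, n) f.

Definition hcoord a m n : cat_hom C m n := coord a (m, n).

(* The objects k outside m..n do not contribute, see hom_eq0. *)
Definition amul_hom a b m n : cat_hom C m n :=
  \sum_(k < n.+1) hcomp (hcoord a k n) (hcoord b m k).

Lemma amul_finite a b :
  finite_set [set p : nat * nat | amul_hom a b p.1 p.2 != 0].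
Proof.
apply: (@sub_finite_set _ _ ((fun q => (q.2.1, q.1.2)) @`
  ([set p | coord a p != 0] `*` [set p | coord b p != 0]))); last first.
  by apply: finite_image; apply: finite_setX; exact: coord_finite.
move=> [m n] /= ab_n0.
have [k abk] : exists k : 'I_n.+1, hcomp (hcoord a k n) (hcoord b m k) != 0.
  apply/existsP; apply: contraNT ab_n0 => /existsPn ab0.
  by apply/eqP/big1 => k _; have := ab0 k; rewrite negbK => /eqP.
exists ((k : nat, n), (m, k : nat)) => //=; split=> /=; apply: contra_neq abk.
  by rewrite /hcoord => ->; exact: linear_map0 (hcomp_linl _).
by rewrite /hcoord => ->; exact: linear_map0 (hcomp_linr _).
Qed.

Definition amul a b : catalg := mkdsum (amul_finite a b).

Lemma hcoord_amul a b m n : hcoord (amul a b) m n = amul_hom a b m n.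
Proof. by []. Qed.

Lemma catalg_ext a b : (forall m n, hcoord a m n = hcoord b m n) -> a = b.
Proof. by move=> ab; apply: dsum_ext => -[m n]; exact: ab. Qed.

Lemma hcoord_linear m n : linear (fun a => hcoord a m n).
Proof. by []. Qed.

Lemma amul_linl b : linear (amul^~ b).
Proof.
move=> r a a'; apply: catalg_ext => m n.
rewrite hcoord_linear !hcoord_amul /amul_hom scaler_sumr -big_split.
by apply: eq_bigr => k _; rewrite hcoord_linear hcomp_linl.
Qed.

Lemma amul_linr a : linear (amul a).
Proof.
move=> r b b'; apply: catalg_ext => m n.
rewrite hcoord_linear !hcoord_amul /amul_hom scaler_sumr -big_split.
by apply: eq_bigr => k _; rewrite hcoord_linear hcomp_linr.
Qed.

Let hcomp0l m n p (f : cat_hom C m n) : hcomp (0 : cat_hom C n p) f = 0.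
Proof. exact: linear_map0 (hcomp_linl f). Qed.

Let hcomp0r m n p (g : cat_hom C n p) : hcomp g (0 : cat_hom C m n) = 0.
Proof. exact: linear_map0 (hcomp_linr g). Qed.

Let linear_sum (U V : lmodType R) (f : U -> V) (I : Type) (r : seq I) F :
  linear f -> f (\sum_(i <- r) F i) = \sum_(i <- r) f (F i).
Proof.
move=> fl; elim: r => [|i r IHr]; first by rewrite !big_nil linear_map0.
by rewrite !big_cons -IHr -[F i]scale1r fl !scale1r.
Qed.

Lemma amulA : associative amul.
Proof.
move=> a b c; apply: catalg_ext => m p; rewrite !hcoord_amul /amul_hom.
transitivity (\sum_(n < p.+1) \sum_(k < p.+1)
    hcomp (hcoord a n p) (hcomp (hcoord b k n) (hcoord c m k))).
  apply: eq_bigr => n _; rewrite hcoord_amul (linear_sum _ _ (hcomp_linr (hcoord a n p))).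
  rewrite (big_ord_widen_cond p.+1 xpredT (fun k : nat =>
    hcomp (hcoord a n p) (hcomp (hcoord b k n) (hcoord c m k)))) //.
  rewrite big_mkcond; apply: eq_bigr => k _ /=; case: ltnP => // nk.
  by rewrite (hom_eq0 nk (hcoord b k n)) hcomp0l hcomp0r.
rewrite exchange_big; apply: eq_bigr => k _ /=.
rewrite hcoord_amul (linear_sum _ _ (hcomp_linl (hcoord c m k))).
by apply: eq_bigr => n _; rewrite hcompA.
Qed.

Definition idem n : catalg := hinj (hid C n).

Definition idem_sum m n : catalg := \sum_(m <= i < n.+1) idem i.

Definition locally_finite : Prop := forall m n, fg_module (cat_hom C m n).

End CategoryAlgebra.

Record amodule (R : comPzRingType) (C : lincat R) := AModule {
  amod_sort :> lmodType R;
  act : catalg C -> amod_sort -> amod_sort;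
  act_linl : forall v, linear (act^~ v);
  act_linr : forall a, linear (act a);
  act_amul : forall a b v, act (amul a b) v = act a (act b v)
}.

Section GradedModules.
Variables (R : comPzRingType) (C : lincat R).

Definition amod_iso (V W : amodule C) : Prop :=
  exists f : V -> W,
    [/\ linear f, bijective f & forall a v, f (act a v) = act a (f v)].

Section Module.
Variable V : amodule C.

Definition asubmodule (W : set V) : Prop :=
  submodule W /\ forall (a : catalg C) v, W v -> W (act a v).

Definition fg_asubmodule (W : set V) : Prop :=
  exists s : seq V, W = smallest asubmodule [set` s].

Definition fg_amodule : Prop := fg_asubmodule [set: V].

Definition noetherian_amodule : Prop :=
  forall W : set V, asubmodule W -> fg_asubmodule W.

Definition idem_part (e : catalg C) : set V := range (act e : V -> V).

(* V is the internal direct sum of the e_n V. *)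
Definition graded : Prop :=
  (forall v : V, exists N (u : nat -> V),
     (forall n, idem_part (idem C n) (u n)) /\ v = \sum_(n < N) u n) /\
  (forall N (u : nat -> V), (forall n, idem_part (idem C n) (u n)) ->
     \sum_(n < N) u n = 0 -> forall n, (n < N)%N -> u n = 0).

End Module.
Arguments idem_part : clear implicits.

Section CentralStability.
Variables (e : catalg C) (V : amodule C).

Lemma Ae_submodule : submodule (range (fun a : catalg C => amul a e)).
Proof. exact: submodule_range (amul_linl e). Qed.

Lemma eAe_submodule : submodule (range (fun a => amul (amul e a) e)).
Proof.
by apply: submodule_range => r a b; rewrite amul_linr amul_linl.
Qed.

Lemma eV_submodule : submodule (idem_part V e).
Proof. exact: submodule_range (act_linr e). Qed.

Definition Ae : lmodType R := lsub Ae_submodule.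
Definition eAe : lmodType R := lsub eAe_submodule.
Definition eV : lmodType R := lsub eV_submodule.

Lemma Ae_lmul_subproof (a : catalg C) (x : Ae) :
  range (fun a : catalg C => amul a e) (amul a (lval x)).
Proof. by have [b _ <-] := lval_mem x; exists (amul a b); rewrite ?amulA. Qed.

Definition Ae_lmul (a : catalg C) (x : Ae) : Ae :=
  inlsub Ae_submodule (Ae_lmul_subproof a x).

Lemma Ae_rmul_subproof (x : Ae) (s : eAe) :
  range (fun a : catalg C => amul a e) (amul (lval x) (lval s)).
Proof.
by have [b _ <-] := lval_mem s; exists (amul (lval x) (amul e b)); rewrite ?amulA.
Qed.

Definition Ae_rmul (x : Ae) (s : eAe) : Ae :=
  inlsub Ae_submodule (Ae_rmul_subproof x s).

Lemma eV_lmul_subproof (s : eAe) (v : eV) :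
  idem_part V e (act (lval s) (lval v)).
Proof.
have [b _ <-] := lval_mem s; exists (act (amul b e) (lval v)) => //.
by rewrite -act_amul amulA.
Qed.

Definition eV_lmul (s : eAe) (v : eV) : eV :=
  inlsub eV_submodule (eV_lmul_subproof s v).

Definition ind_mod : lmodType R := tensor Ae_rmul eV_lmul.

(* The action of A determined by a (x (x) v) = (a x) (x) v. *)
Definition ind_act (a : catalg C) : ind_mod -> ind_mod :=
  tensor_lift (fun (x : Ae) (v : eV) =>
    pure_tensor Ae_rmul eV_lmul (Ae_lmul a x) v).

Lemma Ae_lmul_linl x : linear (Ae_lmul^~ x).
Proof. by move=> r a b; apply: lval_inj; rewrite lval_linear !inlsubK amul_linl. Qed.

Lemma Ae_lmul_linr a : linear (Ae_lmul a).
Proof. by move=> r x y; apply: lval_inj; rewrite lval_linear !inlsubK amul_linr. Qed.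

Lemma ind_balanced a : balanced Ae_rmul eV_lmul (fun (x : Ae) (v : eV) =>
  pure_tensor Ae_rmul eV_lmul (Ae_lmul a x) v).
Proof.
split=> [v r x y|x|x s v].
- by rewrite Ae_lmul_linr pure_tensor_linl.
- exact: pure_tensor_linr.
- rewrite -pure_tensor_mid; congr pure_tensor.
  by apply: lval_inj; rewrite !inlsubK amulA.
Qed.

Lemma ind_act_pure a x v :
  ind_act a (pure_tensor Ae_rmul eV_lmul x v) =
  pure_tensor Ae_rmul eV_lmul (Ae_lmul a x) v.
Proof. by rewrite /ind_act tensor_lift_pure //; exact: ind_balanced. Qed.

Lemma ind_act_linr a : linear (ind_act a).
Proof. exact: tensor_lift_linear (ind_balanced a). Qed.

Lemma ind_act_linl t : linear (ind_act^~ t).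
Proof.
move=> r a b /=; elim/tensor_ind: t => [|k s t Hs Ht|x v].
- by rewrite !(linear_map0 (ind_act_linr _)) scaler0 addr0.
- rewrite !ind_act_linr Hs Ht !scalerDr !scalerA (mulrC k) -!addrA.
  by congr (_ + _); rewrite addrCA.
- by rewrite !ind_act_pure Ae_lmul_linl pure_tensor_linl.
Qed.

Lemma ind_act_amul a b t : ind_act (amul a b) t = ind_act a (ind_act b t).
Proof.
elim/tensor_ind: t => [|k s t Hs Ht|x v].
- by rewrite !(linear_map0 (ind_act_linr _)).
- by rewrite !ind_act_linr Hs Ht.
- rewrite !ind_act_pure; congr pure_tensor.
  by apply: lval_inj; rewrite !inlsubK amulA.
Qed.

(* The A-module Ae (x)_{eAe} eV. *)
Definition ind_amodule : amodule C :=
  AModule ind_act_linl ind_act_linr ind_act_amul.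

End CentralStability.

Definition centrally_stable (V : amodule C) : Prop :=
  exists N0, forall N, (N0 <= N)%N ->
    amod_iso (ind_amodule (idem_sum C 0 N) V) V.

End GradedModules.
Arguments idem_part {R C} V e.

(* Main.v *)
Require Import Defs.
From mathcomp Require Import all_boot all_algebra.
From mathcomp Require Import boolp classical_sets.

(* Let W be a submodule of V and take N so large that V / W is centrally
   stable at N and e = e_{0,N} fixes a finite set of generators of V. Then eV
   is a finitely generated R-module, so eW is spanned by finitely many
   vectors; let U be the A-submodule of W they generate. Since V / W is
   determined by its e-part, which is also the e-part of V / U, and since V / U
   is generated by its e-part, the projection V / U -> V / W is injective, that
   is, W = U. *)

Set Implicit Arguments.
Unset Strict Implicit.
Unset Printing Implicit Defensive.

Import GRing.Theory.
Local Open Scope classical_set_scope.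
Local Open Scope ring_scope.

(** * Linear maps, spans, and submodules over a noetherian ring *)

Section LinearMaps.
Variables (R : comPzRingType) (U V : lmodType R) (f : U -> V).
Hypothesis f_lin : linear f.

Lemma linear_mapD x y : f (x + y) = f x + f y.
Proof. by rewrite -[x]scale1r f_lin !scale1r. Qed.

Lemma linear_mapB x y : f (x - y) = f x - f y.
Proof. by rewrite addrC -scaleN1r f_lin scaleN1r addrC. Qed.

Lemma linear_map_sum (I : Type) (s : seq I) P (F : I -> U) :
  f (\sum_(i <- s | P i) F i) = \sum_(i <- s | P i) f (F i).
Proof. exact: (big_morph f linear_mapD (linear_map0 f_lin)). Qed.

End LinearMaps.

Lemma linear_comp (R : comPzRingType) (U V W : lmodType R) (g : V -> W)
  (f : U -> V) : linear g -> linear f -> linear (g \o f).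
Proof. by move=> gl fl r x y; rewrite /= fl gl. Qed.

Section SpanTheory.
Variables (R : comPzRingType) (V : lmodType R).
Implicit Types (W : set V) (s t : seq V).

Lemma submodule0 W : submodule W -> W 0.
Proof. by move=> /submoduleP[]. Qed.

Lemma submoduleZD W r x y : submodule W -> W x -> W y -> W (r *: x + y).
Proof. by move=> /submoduleP[_]; apply. Qed.
Arguments submoduleZD {W r x y}.

Lemma submoduleD W x y : submodule W -> W x -> W y -> W (x + y).
Proof. by move=> hW Wx Wy; rewrite -[x]scale1r; exact: submoduleZD. Qed.

Lemma submoduleB W x y : submodule W -> W x -> W y -> W (x - y).
Proof. by move=> hW Wx Wy; rewrite addrC -scaleN1r; exact: submoduleZD. Qed.

Lemma lspan_min (X W : set V) : submodule W -> X `<=` W -> lspan X `<=` W.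
Proof. by move=> hW XW; exact: smallest_sub. Qed.

Lemma lspan_mem s x : x \in s -> lspan [set` s] x.
Proof. by move=> sx; exact: sub_gen_smallest. Qed.

(** Linear combinations of sums [p *: y + u] combine coefficients and remainders separately; this is
    what makes the coefficients at [y] an ideal. *)
Lemma scale_lin (a p q : R) (y u v : V) :
  (a * p + q) *: y + (a *: u + v) = a *: (p *: y + u) + (q *: y + v).
Proof.
rewrite scalerDr scalerDl scalerA -!addrA; congr (_ + _).
by rewrite addrCA.
Qed.

Lemma lspan_nil x : lspan [set` [::] : seq V] x -> x = 0.
Proof.
apply: (lspan_min (W := [set 0])) => //.
by apply/submoduleP; split=> // r u v -> ->; rewrite scaler0 addr0.
Qed.

Lemma lspan_cons y s x : lspan [set` y :: s] x ->
  exists r u, lspan [set` s] u /\ x = r *: y + u.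
Proof.
have hs := lspan_submodule [set` s].
pose W := [set x | exists r u, lspan [set` s] u /\ x = r *: y + u].
apply: (lspan_min (W := W)).
  apply/submoduleP; split=> [|a _ _ [r [u [su ->]]] [q [v [sv ->]]]].
    by exists 0, 0; split; [exact: submodule0 hs|rewrite scale0r addr0].
  exists (a * r + q), (a *: u + v); split; first exact: submoduleZD hs su sv.
  exact/esym/scale_lin.
move=> z /=; rewrite inE => /orP[/eqP ->|zs].
  by exists 1, 0; split; [exact: submodule0 hs|rewrite scale1r addr0].
by exists 0, z; split; [exact: lspan_mem|rewrite scale0r add0r].
Qed.

End SpanTheory.

(* Induction on the number of generators: the coefficients at the first
   generator of the elements of W form an ideal of R. *)
Lemma noetherian_fg_submodule (R : comPzRingType) (V : lmodType R) (s : seq V)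
  (W : set V) : noetherian_ring R -> submodule W ->
  W `<=` lspan [set` s] -> fg_submodule W.
Proof.
move=> noethR; elim: s W => [|y s IHs] W hW Ws.
  exists [::]; apply/seteqP; split=> [x /Ws //|x /lspan_nil ->].
  exact: submodule0.
have hs := lspan_submodule [set` s].
(* The elements of [W] that can be written without [y]; the induction hypothesis applies to them. *)
pose W0 := W `&` lspan [set` s].
have hW0 : submodule W0.
  apply/submoduleP; split=> [|r u v [Wu su] [Wv sv]].
    by split; exact: submodule0.
  by split; [exact: submoduleZD hW Wu Wv|exact: submoduleZD hs su sv].
have [t Wt] := IHs _ hW0 (@subIsetr _ W (lspan [set` s])).
pose I : set R^o := [set r : R | exists2 u, lspan [set` s] u & W (r *: y + u)].
have hI : submodule I.
  apply/submoduleP; split=> [|a r q [u su Wu] [v sv Wv]].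
    by exists 0; rewrite ?scale0r ?addr0; exact: submodule0.
  exists (a *: u + v); first exact: submoduleZD hs su sv.
  by rewrite scale_lin; exact: submoduleZD hW Wu Wv.
have [g Ig] := noethR _ hI.
(* Each [r] in [I] is lifted to an element of [W] with coefficient [r] at [y]; outside [I] the value
   0 is a dummy. *)
have /choice[w wP] : forall r : R^o, exists w, I r ->
    W w /\ exists2 u, lspan [set` s] u & w = r *: y + u.
  move=> r; have [[u su Wu]|nIr] := pselect (I r); last by exists 0.
  by exists (r *: y + u) => _; split=> //; exists u.
have gI r : r \in g -> I r by move=> rg; rewrite Ig; exact: lspan_mem.
exists (map w g ++ t); apply/seteqP; split; last first.
  apply: lspan_min => // x /=; rewrite mem_cat => /orP[/mapP[r /gI Ir ->]|xt].
    by have [] := wP _ Ir.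
  have : W0 x by rewrite Wt; exact: lspan_mem.
  by case.
set T := lspan _; have hT : submodule T by exact: lspan_submodule.
(* [J] collects the coefficients realised inside [T]. Once [I] lies in [J], any [x] in [W] differs
   by an element of [W0] from some [z] in [T] with the same coefficient, and [W0] lies in [T]. *)
pose J : set R^o := [set r : R | exists z, [/\ T z, W z &
    exists2 u, lspan [set` s] u & z = r *: y + u]].
suff IJ r : I r -> J r.
  move=> x Wx; have [r [u [su xE]]] := lspan_cons (Ws _ Wx).
  have [|z [Tz Wz [v sv zE]]] := IJ r; first by exists u; rewrite -?xE.
  rewrite -(subrK z x); apply: (submoduleD hT) => //.
  have W0T : W0 `<=` T.
    rewrite Wt; apply: lspan_min => // a at_.
    by apply: lspan_mem; rewrite mem_cat; apply/orP; right.
  apply: W0T; split; first exact: submoduleB hW Wx Wz.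
  by rewrite xE zE opprD addrACA subrr add0r; exact: submoduleB hs su sv.
(* As [J] is an ideal, only the generators [g] of [I] matter, and their lifts under [w] are in
   [T]. *)
rewrite Ig; apply: (lspan_min (W := J)) => [|{}r rg]; last first.
  have [Wr rE] := wP _ (gI _ rg); exists (w r); split=> //.
  by apply: lspan_mem; rewrite /= mem_cat map_f.
apply/submoduleP; split=> [|a p q].
  exists 0; split; [exact: submodule0 hT|exact: submodule0 hW|].
  by exists 0; [exact: submodule0 hs|rewrite scale0r addr0].
move=> [z [Tz Wz [u su zE]]] [z' [Tz' Wz' [v sv z'E]]].
exists (a *: z + z'); split.
- exact: submoduleZD hT Tz Tz'.
- exact: submoduleZD hW Wz Wz'.
- exists (a *: u + v); first exact: submoduleZD hs su sv.
  by rewrite zE z'E scale_lin.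
Qed.

Lemma submodule_preimage (R : comPzRingType) (U V : lmodType R) (f : U -> V)
  (W : set V) : linear f -> submodule W -> submodule (f @^-1` W).
Proof.
move=> fl hW; apply/submoduleP; split=> [|r u v Wu Wv] /=.
  by rewrite (linear_map0 fl); exact: submodule0 hW.
by rewrite fl; exact: submoduleZD hW Wu Wv.
Qed.

(** * Idempotents and corners of the category algebra *)

Section CatalgTheory.
Variables (R : comPzRingType) (C : lincat R).
Let homs (p : nat * nat) := cat_hom C p.1 p.2.
Implicit Types (a b : catalg C) (i j k m n N : nat).

Lemma hinj_in m n (f : cat_hom C m n) : hcoord (hinj f) m n = f.
Proof. exact: (@dinj_in R _ homs (m, n) f). Qed.

Lemma hinj_out m n p q (f : cat_hom C m n) :
  (m, n) != (p, q) -> hcoord (hinj f) p q = 0.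
Proof. exact: (@dinj_out R _ homs (m, n) f (p, q)). Qed.

Lemma hinj_linear m n : linear (@hinj R C m n).
Proof. exact: (@dinj_linear R _ homs (m, n)). Qed.

Lemma hcoord_sum m n (I : Type) (s : seq I) (P : pred I) (F : I -> catalg C) :
  hcoord (\sum_(i <- s | P i) F i) m n = \sum_(i <- s | P i) hcoord (F i) m n.
Proof. exact: linear_map_sum (@hcoord_linear R C m n) _ _ _ _. Qed.

Lemma hcoord_idem_mull i a m n :
  hcoord (amul (idem C i) a) m n = if i == n then hcoord a m n else 0.
Proof.
rewrite hcoord_amul /amul_hom; have [->|i_n] := eqVneq i n.
  rewrite (bigD1 ord_max) //= hinj_in hcomp1f big1 ?addr0 // => k kn.
  rewrite hinj_out ?(linear_map0 (hcomp_linl _)) //.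
  by apply: contra_neq kn => -[nk]; exact/val_inj.
apply: big1 => k _; rewrite hinj_out ?(linear_map0 (hcomp_linl _)) //.
by apply: contra_neq i_n => -[].
Qed.

Lemma hcoord_idem_mulr i a m n :
  hcoord (amul a (idem C i)) m n = if i == m then hcoord a m n else 0.
Proof.
rewrite hcoord_amul /amul_hom; have [->|i_m] := eqVneq i m; last first.
  apply: big1 => k _; rewrite hinj_out ?(linear_map0 (hcomp_linr _)) //.
  by apply: contra_neq i_m => -[].
(* The sum in [amul_hom] stops at [n], so for [n < m] it has no term at [m]; there both sides vanish
   because the hom module is zero. *)
have [nm|mn] := ltnP n m.
  rewrite (hom_eq0 nm (hcoord a m n)) big1 // => k _.
  rewrite hinj_out ?(linear_map0 (hcomp_linr _)) //.
  apply/eqP => -[mk]; have := ltn_ord k.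
  by rewrite -mk ltnS leqNgt nm.
rewrite (bigD1 (Ordinal (mn : (m < n.+1)%N))) //= hinj_in hcompf1.
rewrite big1 ?addr0 // => k km.
rewrite hinj_out ?(linear_map0 (hcomp_linr _)) //.
by apply: contra_neq km => -[mk]; exact/val_inj.
Qed.

Lemma idem_idem i : amul (idem C i) (idem C i) = idem C i.
Proof.
apply: catalg_ext => m n; rewrite hcoord_idem_mull; case: eqVneq => // i_n.
by rewrite hinj_out //; apply: contra_neq i_n => -[].
Qed.

Lemma idem_orth i j : i != j -> amul (idem C i) (idem C j) = 0.
Proof.
move=> ij; apply: catalg_ext => m n; rewrite hcoord_idem_mull.
case: eqVneq => // <-; rewrite hinj_out //.
by apply: contra_neq ij => -[].
Qed.

Lemma sum_delta (V : nmodType) N k (x : V) :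
  \sum_(0 <= i < N.+1) (if i == k then x else 0) = if (k <= N)%N then x else 0.
Proof.
rewrite big_mkord -big_mkcond /=; case: leqP => [kN|Nk].
  by rewrite (big_pred1 (Ordinal (kN : (k < N.+1)%N))).
by rewrite big_pred0 // => i; apply: ltn_eqF; exact: leq_trans (ltn_ord i) Nk.
Qed.

Lemma hcoord_idem_sum_mull N a m n : hcoord (amul (idem_sum C 0 N) a) m n =
  if (n <= N)%N then hcoord a m n else 0.
Proof.
rewrite (linear_map_sum (amul_linl a)) hcoord_sum -(sum_delta N n).
by apply: eq_bigr => i _; exact: hcoord_idem_mull.
Qed.

Lemma hcoord_idem_sum_mulr N a m n : hcoord (amul a (idem_sum C 0 N)) m n =
  if (m <= N)%N then hcoord a m n else 0.
Proof.
rewrite (linear_map_sum (amul_linr a)) hcoord_sum -(sum_delta N m).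
by apply: eq_bigr => i _; exact: hcoord_idem_mulr.
Qed.

Lemma idem_sum_mul_idem N i :
  (i <= N)%N -> amul (idem_sum C 0 N) (idem C i) = idem C i.
Proof.
move=> iN; apply: catalg_ext => m n; rewrite hcoord_idem_sum_mull.
case: leqP => // Nn; rewrite hinj_out //.
by apply: contraTneq Nn => -[_ <-]; rewrite -leqNgt.
Qed.

Lemma idem_sum_idem N :
  amul (idem_sum C 0 N) (idem_sum C 0 N) = idem_sum C 0 N.
Proof.
rewrite (linear_map_sum (amul_linr _)); apply: eq_big_nat => i iN.
exact: idem_sum_mul_idem.
Qed.

(** Multiplication by e_{0,N} on one side keeps the components whose end on that side is at most
    [N]. Hence eAe is a finite sum of hom modules, to which local finiteness applies. *)
Lemma idem_sum_corner N a :
  amul (amul (idem_sum C 0 N) a) (idem_sum C 0 N) =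
  \sum_(0 <= i < N.+1) \sum_(0 <= j < N.+1) hinj (hcoord a i j).
Proof.
apply: catalg_ext => m n.
rewrite hcoord_idem_sum_mulr hcoord_idem_sum_mull hcoord_sum -(sum_delta N m).
apply: eq_bigr => i _; rewrite hcoord_sum -(sum_delta N n).
case: eqVneq => [->|i_m]; last first.
  by rewrite big1 // => j _; rewrite hinj_out //; apply: contra_neq i_m => -[].
apply: eq_bigr => j _; case: eqVneq => [->|j_n]; first by rewrite hinj_in.
by rewrite hinj_out //; apply: contra_neq j_n => -[].
Qed.

Lemma corner_fg N : locally_finite C -> exists s : seq (catalg C), forall a,
  lspan [set` s] (amul (amul (idem_sum C 0 N) a) (idem_sum C 0 N)).
Proof.
move=> lf; pose g i j := sval (cid (lf i j)).
have gP i j : setT = lspan [set` g i j] by rewrite /g; case: cid.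
pose I := index_iota 0 N.+1.
exists (flatten [seq [seq hinj x | x <- g p.1 p.2]
  | p <- [seq (i, j) | i <- I, j <- I]]) => a.
set T := lspan _; have hT : submodule T by exact: lspan_submodule.
rewrite idem_sum_corner !big_seq.
apply: (@big_ind _ T) => [|x y Tx Ty|i iN]; first exact: submodule0 hT.
  exact: submoduleD hT Tx Ty.
rewrite big_seq; apply: (@big_ind _ T) => [|x y Tx Ty|j jN].
- exact: submodule0 hT.
- exact: submoduleD hT Tx Ty.
have : lspan [set` g i j] (hcoord a i j) by rewrite -gP.
apply: (@lspan_min _ _ _ (@hinj R C i j @^-1` T)) => [|x gx].
  exact: submodule_preimage (@hinj_linear i j) hT.
apply: lspan_mem; apply/flattenP; exists [seq hinj x | x <- g i j].
  apply/mapP; exists (i, j) => //; apply/allpairsP; exists (i, j).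
  by split.
exact: map_f.
Qed.

End CatalgTheory.

(** * Graded modules, their generators and their quotients *)

Section ModuleTheory.
Variables (R : comPzRingType) (C : lincat R).

Section OneModule.
Variable V : amodule C.
Implicit Types (v : V) (W X : set V) (s : seq V).

Lemma smallest_asubmodule (X : set V) :
  asubmodule (smallest (@asubmodule R C V) X).
Proof.
split=> [|a v Xv W [hW XW]].
  apply/submoduleP; split=> [W [hW _]|r u v Xu Xv W hW].
    exact: submodule0 hW.1.
  exact: submoduleZD hW.1.1 (Xu W hW) (Xv W hW).
by apply: hW.2; exact: Xv.
Qed.

Lemma idem_part_fix n v : idem_part V (idem C n) v -> act (idem C n) v = v.
Proof. by move=> [w _ <-]; rewrite -act_amul idem_idem. Qed.

(* The idempotents project onto the summands, so the sum of the e_n V is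
   direct in every module. *)
Lemma gradedP :
  graded V <-> forall v, exists N (u : nat -> V),
    (forall n, idem_part V (idem C n) (u n)) /\ v = \sum_(n < N) u n.
Proof.
split=> [[]//|dec]; split=> // N u uE u0 k kN.
have := congr1 (act (idem C k)) u0.
rewrite (linear_map_sum (act_linr _)) (linear_map0 (act_linr _)).
rewrite (bigD1 (Ordinal kN)) //= idem_part_fix // big1 ?addr0 // => n nk.
rewrite -(idem_part_fix (uE n)) -act_amul.
rewrite idem_orth ?(linear_map0 (act_linl _)) //.
by apply: contra_neq nk => kn; apply/val_inj.
Qed.

(** A vector has finitely many components, and e_{0,N} fixes those of degree at most N. *)
Lemma graded_fix_vec v : graded V ->
  exists N0, forall N, (N0 <= N)%N -> act (idem_sum C 0 N) v = v.
Proof.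
move=> [/(_ v)[N0 [u [uE ->]]] _]; exists N0 => N N0N.
rewrite (linear_map_sum (act_linr _)); apply: eq_bigr => n _.
rewrite -(idem_part_fix (uE n)) -act_amul idem_sum_mul_idem //.
exact: leq_trans (ltnW (ltn_ord n)) N0N.
Qed.

Lemma graded_fix_seq s : graded V -> exists N0, forall N, (N0 <= N)%N ->
  forall v, v \in s -> act (idem_sum C 0 N) v = v.
Proof.
move=> gV; elim: s => [|w s [N1 IHs]]; first by exists 0%N.
have [N2 wN] := graded_fix_vec w gV.
exists (maxn N1 N2) => N; rewrite geq_max => /andP[N1N N2N] v.
by rewrite inE => /predU1P[->|]; [exact: wN|exact: IHs].
Qed.

Section Generators.
Variables (e : catalg C) (s : seq V).
Hypothesis e_idem : amul e e = e.
Hypothesis s_fix : forall v, v \in s -> act e v = v.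
Hypothesis s_gen : setT = smallest (@asubmodule R C V) [set` s].

Lemma asubmodule_full W : asubmodule W -> (forall v, v \in s -> W v) ->
  forall v, W v.
Proof.
move=> hW sW v; have : [set: V] v by []; rewrite s_gen.
exact: smallest_sub.
Qed.

(** Each generator [x] equals ex, so ax = (ae)x and V = AeV. Since [W] is only an R-submodule, [P]
    also asks for all multiples of [v], which makes it an A-submodule. *)
Lemma submodule_full W : submodule W ->
  (forall a v, W (act (amul a e) v)) -> forall v, W v.
Proof.
move=> hW eW v; pose P := [set v | W v /\ forall a, W (act a v)].
suff [] : P v by [].
apply: asubmodule_full => [|x sx].
  split=> [|a x [_ Wx]]; last by split=> // b; rewrite -act_amul.
  apply/submoduleP; split=> [|r x y [Wx Wax] [Wy Way]].
    by split=> [|a]; rewrite ?(linear_map0 (act_linr _)); exact: submodule0 hW.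
  split=> [|a]; first exact: submoduleZD hW Wx Wy.
  by rewrite act_linr; exact: submoduleZD hW (Wax a) (Way a).
rewrite /P /=; split=> [|a]; rewrite -(s_fix sx).
  by rewrite -[in act _ _]e_idem.
by rewrite -act_amul.
Qed.

(** For a generator x = ex one has eax = (eae)x, so products of generators of eAe with generators of
    V span eV over R. *)
Lemma idem_part_fg (g : seq (catalg C)) :
  (forall a, lspan [set` g] (amul (amul e a) e)) ->
  exists t : seq V, idem_part V e `<=` lspan [set` t].
Proof.
move=> gP; exists [seq act b x | b <- g, x <- s] => _ [v _ <-].
set T := lspan _; have hT : submodule T by exact: lspan_submodule.
(* Asking for eAv instead of ev makes [P] stable under A; taking [a] to be [e] recovers ev. *)
pose P := [set v | forall a, T (act (amul e a) v)].
suff /(_ e) : P v by rewrite e_idem.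
apply: asubmodule_full => [|x sx a].
  split=> [|a x Px b]; last by rewrite -act_amul -amulA; exact: Px.
  apply/submoduleP; split=> [a|r x y Px Py a] /=.
    by rewrite (linear_map0 (act_linr _)); exact: submodule0 hT.
  by rewrite act_linr; exact: submoduleZD hT (Px a) (Py a).
rewrite -(s_fix sx) -act_amul; have := gP a.
apply: (@lspan_min _ _ _ [set b | T (act b x)]) => [|b gb].
  exact: submodule_preimage (act_linl x) hT.
by apply: lspan_mem; apply/allpairsP; exists (b, x).
Qed.

End Generators.
End OneModule.

Section QuotientModule.
Variables (V : amodule C) (W : set V).
Hypothesis hW : asubmodule W.

Local Notation proj := (lproj hW.1).

Definition quot_act (a : catalg C) (x : lquot hW.1) : lquot hW.1 :=
  proj (act a (lrepr x)).

Lemma quot_act_proj a v : quot_act a (proj v) = proj (act a v).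
Proof.
apply/lproj_eq; rewrite -(linear_mapB (act_linr a)); apply: hW.2.
by apply/(lproj_eq hW.1); rewrite lreprK.
Qed.

Lemma quot_act_linl x : linear (quot_act^~ x).
Proof. by move=> r a b; rewrite /quot_act act_linl lproj_linear. Qed.

Lemma quot_act_linr a : linear (quot_act a).
Proof.
move=> r x y; have [u ->] := lproj_surj x; have [v ->] := lproj_surj y.
by rewrite -lproj_linear !quot_act_proj act_linr lproj_linear.
Qed.

Lemma quot_act_amul a b x : quot_act (amul a b) x = quot_act a (quot_act b x).
Proof.
by have [v ->] := lproj_surj x; rewrite !quot_act_proj act_amul.
Qed.

Definition quot_amodule : amodule C :=
  AModule quot_act_linl quot_act_linr quot_act_amul.

(** Only the decomposition of vectors has to descend; directness is automatic by [gradedP]. *)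
Lemma graded_quot : graded V -> graded quot_amodule.
Proof.
move=> [dec _]; apply/gradedP => x; have [v ->] := lproj_surj x.
have [N [u [uE ->]]] := dec v; exists N, (proj \o u); split=> [n|].
  have [w _ wE] := uE n; exists (proj w) => //; rewrite /= -wE.
  exact: quot_act_proj.
exact: linear_map_sum (@lproj_linear _ _ _ hW.1) _ _ _ _.
Qed.

Lemma fg_quot : fg_amodule V -> fg_amodule quot_amodule.
Proof.
move=> [s sV]; exists (map proj s); apply/seteqP; split=> // x _.
have [v ->] := lproj_surj x.
set T := smallest _ _.
have [hT Tact] : asubmodule T by exact: smallest_asubmodule.
apply: (asubmodule_full sV (W := proj @^-1` T)) => [|u su].
  split=> [|a u Tu]; first exact: submodule_preimage (@lproj_linear _ _ _ _) hT.
  by rewrite /= -quot_act_proj; exact: Tact.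
by apply: sub_gen_smallest; rewrite /= map_f.
Qed.

End QuotientModule.

End ModuleTheory.

(** * The induced module, and linear maps out of a centrally stable module *)

Section Induced.
Variables (R : comPzRingType) (C : lincat R) (e : catalg C).
Hypothesis e_idem : amul e e = e.

Lemma Ae_fix (x : Ae e) : amul (lval x) e = lval x.
Proof. by have [b _ <-] := lval_mem x; rewrite -amulA e_idem. Qed.

Lemma eAe_fixl (s : eAe e) : amul e (lval s) = lval s.
Proof. by have [b _ <-] := lval_mem s; rewrite !amulA e_idem. Qed.

Lemma eAe_fixr (s : eAe e) : amul (lval s) e = lval s.
Proof. by have [b _ <-] := lval_mem s; rewrite -amulA e_idem. Qed.

Lemma eV_fix (V : amodule C) (q : eV e V) : act e (lval q) = lval q.
Proof. by have [v _ <-] := lval_mem q; rewrite -act_amul e_idem. Qed.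

Lemma e_in_Ae : range (fun a : catalg C => amul a e) e.
Proof. by exists e. Qed.

Definition Ae_gen : Ae e := inlsub (Ae_submodule e) e_in_Ae.

Section OneModule.
Variable Q : amodule C.

Local Notation ten := (pure_tensor (@Ae_rmul R C e) (@eV_lmul R C e Q)).

(** As x = xe, the elements e ⊗ q generate the induced module. *)
Lemma pure_tensor_gen x q : ten x q = ind_act (lval x) (ten Ae_gen q).
Proof.
rewrite ind_act_pure; congr pure_tensor; apply: lval_inj.
by rewrite inlsubK Ae_fix.
Qed.

(** Since ex = exe lies in eAe, it crosses the tensor sign: ex ⊗ q = e ⊗ (ex)q. *)
Lemma ind_idem_part (t : ind_mod e Q) : exists q, ind_act e t = ten Ae_gen q.
Proof.
elim/tensor_ind: t => [|r s t [p sE] [q tE]|x q].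
- exists 0; rewrite (linear_map0 (ind_act_linr _)).
  by rewrite (linear_map0 (pure_tensor_linr _ _ _)).
- by exists (r *: p + q); rewrite ind_act_linr sE tE pure_tensor_linr.
have exP : range (fun a => amul (amul e a) e) (amul e (lval x)).
  by exists (lval x); rewrite // -amulA Ae_fix.
exists (eV_lmul (inlsub (eAe_submodule e) exP) q).
rewrite -pure_tensor_mid ind_act_pure; congr pure_tensor.
by apply: lval_inj; rewrite !inlsubK amulA e_idem.
Qed.

(* An isomorphism f need not be the natural map x (x) q |-> x q; it differs
   from it by the automorphism q |-> f (e (x) q) of eQ. *)
Lemma ind_iso_lift (X : lmodType R) (g : Ae e -> eV e Q -> X) :
  amod_iso (ind_amodule e Q) Q ->
  balanced (@Ae_rmul R C e) (@eV_lmul R C e Q) g ->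
  exists2 h : Q -> X, linear h & forall x q, h (act (lval x) (lval q)) = g x q.
Proof.
move=> [f [f_lin [f' fK f'K] f_act]] [g_linl g_linr g_mid].
have f'_lin : linear f'.
  by move=> r x y; rewrite -[x in LHS]f'K -[y in LHS]f'K -f_lin fK.
have f'_act a x : f' (act a x) = ind_act a (f' x).
  by rewrite -[x in LHS]f'K -f_act fK.
(* Since e fixes e ⊗ q, [f] sends it into eQ. The resulting [gamma] is eAe-linear because s(e ⊗ q) =
   e ⊗ sq. *)
have gamma_mem q : idem_part Q e (f (ten Ae_gen q)).
  exists (f (ten Ae_gen q)) => //.
  by rewrite -f_act; congr f; exact/esym/(pure_tensor_gen Ae_gen q).
pose gamma q : eV e Q := inlsub (eV_submodule e Q) (gamma_mem q).
have gamma_lin : linear gamma.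
  by move=> r p q; apply: lval_inj; rewrite lval_linear !inlsubK
    pure_tensor_linr f_lin.
have gamma_eAe s q : gamma (eV_lmul s q) = eV_lmul s (gamma q).
  apply: lval_inj; rewrite !inlsubK -f_act; congr f.
  rewrite -[RHS]/(ind_act (lval s) (ten Ae_gen q)) ind_act_pure.
  rewrite -pure_tensor_mid.
  by congr pure_tensor; apply: lval_inj; rewrite !inlsubK eAe_fixl eAe_fixr.
(* The twist by [gamma] undoes the deviation of [f]: if [f'] sends q to e ⊗ p, then [gamma p] is q,
   so xq goes to [g x (gamma p)], which is [g x q]. *)
pose g' x q := g x (gamma q).
have g'B : balanced (@Ae_rmul R C e) (@eV_lmul R C e Q) g'.
  split=> [q|x r p q|x s q]; rewrite /g'; first exact: g_linl.
    by rewrite gamma_lin g_linr.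
  by rewrite g_mid gamma_eAe.
exists (tensor_lift g' \o f').
  exact: linear_comp (tensor_lift_linear g'B) f'_lin.
move=> x q; have [p pE] := ind_idem_part (f' (lval q)).
have f'q : f' (lval q) = ten Ae_gen p by rewrite -pE -f'_act eV_fix.
rewrite /= f'_act f'q -pure_tensor_gen tensor_lift_pure // /g'.
by congr g; apply: lval_inj; rewrite inlsubK -f'q f'K.
Qed.

End OneModule.

(* The isomorphism determines V / W from its e-part, and so yields a map
   V / W -> V / U compatible with the two projections. *)
Lemma asubmodule_idem_part_sub (V : amodule C) (s : seq V) (W U : set V)
  (hW : asubmodule W) : asubmodule U ->
  (forall v, v \in s -> act e v = v) ->
  setT = smallest (@asubmodule R C V) [set` s] ->
  amod_iso (ind_amodule e (quot_amodule hW)) (quot_amodule hW) ->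
  (forall w, W w -> U (act e w)) -> W `<=` U.
Proof.
move=> hU s_fix s_gen iso eWU; set Q := quot_amodule hW.
pose projU := lproj hU.1; pose projW : V -> Q := lproj hW.1.
have projU_lin : linear projU by exact: lproj_linear.
(* If v - v' lies in W, then e(v - v') lies in U; so ev modulo U depends only on v modulo W. *)
have lift (v v' : V) a : projW v = projW v' ->
    projU (act a (act e v)) = projU (act a (act e v')).
  move=> /lproj_eq Wvv'; apply/lproj_eq; rewrite -!(linear_mapB (act_linr _)).
  exact/hU.2/eWU.
pose g (x : Ae e) (q : eV e Q) := projU (act (lval x) (act e (lrepr (lval q)))).
have gB : balanced (@Ae_rmul R C e) (@eV_lmul R C e Q) g.
  split=> [q r x y|x r p q|x t q].
  - by rewrite /g lval_linear act_linl projU_lin.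
  - rewrite /g -projU_lin -!act_linr; apply: lift.
    by rewrite /projW lproj_linear !lreprK lval_linear.
  (* With te = t the inner e is absorbed, and t = et puts an e in front of tv, where [lift]
     applies. *)
  rewrite /g inlsubK -act_amul -amulA eAe_fixr act_amul.
  rewrite -[in LHS](eAe_fixl t) act_amul; apply: lift.
  by rewrite /projW -(quot_act_proj hW) !lreprK.
have [h h_lin hE] := ind_iso_lift iso gB.
(* Both sides are linear, so they need to agree only on AeV. There aev = (ae)(ev), and the class of
   ev lies in eQ, where [hE] computes [h]. *)
have hproj : forall v, h (projW v) = projU v.
  apply: (submodule_full e_idem s_fix s_gen
    (W := [set v | h (projW v) = projU v])) => [|a v] /=.
    apply/submoduleP; split=> [|r u v /= hu hv].
      by rewrite /= /projU /projW !(linear_map0 (@lproj_linear _ _ _ _))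
        (linear_map0 h_lin).
    by rewrite /= /projW lproj_linear h_lin -!/(projW _) hu hv projU_lin.
  have aeP : range (fun a : catalg C => amul a e) (amul a e) by exists a.
  have evP : idem_part Q e (projW (act e v)).
    by exists (projW v) => //; exact: quot_act_proj.
  have aeE : act (amul a e) (act e v) = act (amul a e) v.
    by rewrite -act_amul -amulA e_idem.
  rewrite -[in LHS]aeE /projW -(quot_act_proj hW).
  have -> := hE (inlsub (Ae_submodule e) aeP) (inlsub (eV_submodule e Q) evP).
  rewrite /g !inlsubK (lift _ (act e v)); last by rewrite /projW lreprK.
  by congr projU; rewrite -[act e (act e v)]act_amul e_idem.
(* The class of [w] modulo W is 0, so its class modulo U is h(0) = 0. *)
move=> w Ww; rewrite -[w]subr0; apply/(lproj_eq hU.1); rewrite -[LHS]hproj.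
have -> : projW w = 0.
  rewrite -(linear_map0 (@lproj_linear _ _ _ hW.1)).
  by apply/lproj_eq; rewrite subr0.
by rewrite (linear_map0 h_lin); exact/esym/(linear_map0 projU_lin).
Qed.

End Induced.

Theorem corollary3p4 (R : comPzRingType) (C : lincat R) :
  noetherian_ring R -> locally_finite C ->
  (forall V : amodule C, graded V -> fg_amodule V -> centrally_stable V) ->
  forall V : amodule C, graded V -> fg_amodule V -> noetherian_amodule V.
Proof.
move=> noethR lfC allcs V gV fgV W hW.
have [s s_gen] := fgV.
have [N1 csQ] := allcs _ (graded_quot hW gV) (fg_quot hW fgV).
have [N2 s_fixN] := graded_fix_seq s gV.
(* [N1] serves the central stability of V / W, and [N2] makes [e] fix the generators of V. *)
pose N := maxn N1 N2; pose e := idem_sum C 0 N.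
have e_idem : amul e e = e by exact: idem_sum_idem.
have s_fix : forall v, v \in s -> act e v = v by apply: s_fixN; exact: leq_maxr.
have [g gP] := corner_fg N lfC.
have [b bP] := idem_part_fg e_idem s_fix s_gen gP.
(* This intersection is eW, because [e] is idempotent and W is stable under A. *)
have eW_sub : submodule (W `&` idem_part V e).
  have hI := eV_submodule e V.
  apply/submoduleP; split=> [|r u v [Wu eu] [Wv ev]].
    by split; [exact: submodule0 hW.1|exact: submodule0 hI].
  by split; [exact: submoduleZD hW.1 Wu Wv|exact: submoduleZD hI eu ev].
have [|t tE] := noetherian_fg_submodule noethR eW_sub (s := b).
  by move=> v [_ /bP].
have hU := smallest_asubmodule [set` t].
exists t; apply/seteqP; split; last first.
  apply: smallest_sub => // v tv.
  have : (W `&` idem_part V e) v by rewrite tE; exact: lspan_mem.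
  by case.
apply: (asubmodule_idem_part_sub e_idem (hW := hW) hU s_fix s_gen).
  by apply: csQ; exact: leq_maxl.
move=> w Ww; have : (W `&` idem_part V e) (act e w).
  by split; [exact: hW.2|exists w].
rewrite tE; apply: lspan_min; first exact: hU.1.
exact: sub_gen_smallest.
Qed.
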